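(* Let $\bm{X}$ be a centered $d$-dimensional random vector such that $|\bm{X}|\le M$ almost surely, for some $M>0$. Then, for any positive integers $n$ and $N$ with $N\ge 6dn$, if $\bm{X}_1,\dots,\bm{X}_N$ are i.i.d. copies of $\bm{X}$, \[ \mathbb{P}\!\left(\operatorname{dist}\!\left(\bm{0},\operatorname{conv}\{\bm{X}_1,\dots,\bm{X}_N\}\right)\le \frac{2M}{n}\right) > 1-2^{-d}. \]
   Context: $|\cdot|$ denotes the Euclidean norm on $\mathbb{R}^d$. For $A\subset\mathbb{R}^d$, $\operatorname{conv}A$ denotes the convex hull of $A$ (the set of all finite convex combinations of points of $A$), and $\operatorname{dist}(\bm\theta,\operatorname{conv}A):=\inf_{\bm a\in\operatorname{conv}A}|\bm\theta-\bm a|$. *)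

(* Defs.v *)
From HB Require Import structures.
From mathcomp Require Import all_boot all_order all_algebra.
From mathcomp Require Import all_classical all_reals all_analysis.
Set Implicit Arguments. Unset Strict Implicit. Unset Printing Implicit Defensive.
Import Order.TTheory GRing.Theory Num.Theory.
Local Open Scope classical_set_scope.
Local Open Scope ring_scope.

(* Points of R^d are represented as d.-tuple R; n.-tuple R carries the
   product sigma-algebra (generated by the coordinate projections) in
   MathComp-Analysis, i.e. the Borel sigma-algebra of R^d. *)

Definition edist (R : realType) (d : nat) (x y : d.-tuple R) : R :=
  Num.sqrt (\sum_(i < d) (tnth x i - tnth y i) ^+ 2).

Definition zero_vec (R : realType) (d : nat) : d.-tuple R := [tuple (0 : R) | i < d].

Definition enorm (R : realType) (d : nat) (x : d.-tuple R) : R :=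
  edist x (zero_vec R d).

Definition conv_hull (R : realType) (d : nat) (A : set (d.-tuple R)) : set (d.-tuple R) :=
  [set v | exists (m : nat) (p : 'I_m -> d.-tuple R) (lam : 'I_m -> R),
     [/\ (forall j, A (p j)), (forall j, 0 <= lam j), \sum_(j < m) lam j = 1 &
         forall i : 'I_d, tnth v i = \sum_(j < m) lam j * tnth (p j) i]].

Definition dist_set (R : realType) (d : nat) (theta : d.-tuple R)
  (C : set (d.-tuple R)) : R :=
  inf [set edist theta a | a in C].

Definition random_vector (R : realType) (dT : measure_display) (T : measurableType dT)
  (d : nat) (X : T -> d.-tuple R) : Prop :=
  measurable_fun setT X.

Definition same_law (R : realType) (dT dT' : measure_display)
  (T : measurableType dT) (T' : measurableType dT') (P : probability T R)
  (P' : probability T' R) (d : nat) (X : T -> d.-tuple R) (Y : T' -> d.-tuple R) : Prop :=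
  forall B : set (d.-tuple R), measurable B -> P (X @^-1` B) = P' (Y @^-1` B).

(* Mutual independence of the random vectors Y_0, ..., Y_{N-1}:
   the product rule holds for every family of measurable sets
   (subfamilies are obtained by taking B k = setT). *)
Definition mutually_independent (R : realType) (dT : measure_display)
  (T : measurableType dT) (P : probability T R) (d N : nat)
  (Y : 'I_N -> T -> d.-tuple R) : Prop :=
  forall B : 'I_N -> set (d.-tuple R), (forall k, measurable (B k)) ->
    P (\bigcap_(k in [set: 'I_N]) (Y k @^-1` B k)) =
    (\prod_(k < N) P (Y k @^-1` B k))%E.

(* Main.v *)
(** If 0 is far from the convex hull of y_1, ..., y_N, let z be the point of
    least norm of that hull. It satisfies <z, y_i> >= |z|^2 for all i and lies in
    the hull of at most d of the y_i; hence it is also the point of least norm of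
    the hull of any subfamily S containing these d points, and the points outside
    S all fall into the halfspace that z(S) cuts out. Conversely, for a fixed S,
    the points outside S are independent of z(S); since X is centered and bounded,
    each lies in that halfspace with probability at most b < 1. Averaging over the
    sets K of k points outside S gives
      P(far) * 'C(N - d, k) <= 'C(N, k) * b ^ k,
    and k = 3dn yields the bound 2^-d. To keep independence elementary, the vectors
    are first rounded to a finite grid of mesh small against M / n, so that all
    probabilities are finite sums of products of weights. *)

Require Import Defs.
From HB Require Import structures.
From mathcomp Require Import all_boot all_order all_algebra.
From mathcomp Require Import all_classical all_reals all_analysis.
From mathcomp Require Import measurable_realfun.
From mathcomp Require Import ring lra zify.
Import Order.TTheory GRing.Theory Num.Theory.
Import numFieldNormedType.Exports.
Local Open Scope classical_set_scope.
Local Open Scope ring_scope.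

(** * Inner product of row vectors *)

Section Dot.
Context {R : realType} {d : nat}.
Implicit Types u v w : 'rV[R]_d.

Definition dot u v : R := \sum_i u 0 i * v 0 i.

Lemma dotC u v : dot u v = dot v u.
Proof. by apply: eq_bigr => i _; rewrite mulrC. Qed.

Lemma dotDl u v w : dot (u + v) w = dot u w + dot v w.
Proof. by rewrite -big_split; apply: eq_bigr => i _; rewrite mxE mulrDl. Qed.

Lemma dotZl a u v : dot (a *: u) v = a * dot u v.
Proof. by rewrite mulr_sumr; apply: eq_bigr => i _; rewrite mxE mulrA. Qed.

Lemma dotDr u v w : dot w (u + v) = dot w u + dot w v.
Proof. by rewrite dotC dotDl !(dotC w). Qed.

Lemma dotZr a u v : dot v (a *: u) = a * dot v u.
Proof. by rewrite dotC dotZl (dotC v). Qed.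

Lemma dotNr u v : dot v (- u) = - dot v u.
Proof. by rewrite -scaleN1r dotZr mulN1r. Qed.

Lemma dotNl u v : dot (- u) v = - dot u v.
Proof. by rewrite dotC dotNr dotC. Qed.

Lemma dot_ge0 u : 0 <= dot u u.
Proof. by apply: sumr_ge0 => i _; rewrite -expr2 sqr_ge0. Qed.

Lemma dot_eq0 u : (dot u u == 0) = (u == 0).
Proof.
apply/idP/idP => [|/eqP ->]; last first.
  by rewrite /dot big1// => i _; rewrite mxE mul0r.
rewrite psumr_eq0 => [/allP h|i _]; last by rewrite -expr2 sqr_ge0.
apply/eqP/rowP => i; rewrite mxE; apply/eqP.
by have := h i (mem_index_enum _); rewrite mulf_eq0 orbb.
Qed.

Lemma dot_mulmxl N (l : 'rV[R]_N) (Y : 'M[R]_(N, d)) u :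
  dot (l *m Y) u = \sum_j l 0 j * dot (row j Y) u.
Proof.
rewrite /dot; under eq_bigr do rewrite mxE mulr_suml.
rewrite exchange_big; apply: eq_bigr => j _ /=; rewrite mulr_sumr.
by apply: eq_bigr => i _; rewrite !mxE mulrA.
Qed.

Lemma dot_subsq u v : dot (u - v) (u - v) = dot u u - 2 * dot u v + dot v v.
Proof.
rewrite dotDl !dotDr !dotNl !dotNr (dotC v u); ring.
Qed.

End Dot.

(** * Convex weights, the minimal-norm point and a Carathéodory reduction *)

Section MinimalNorm.
Context {R : realType}.

Definition simplex N : set 'rV[R]_N :=
  [set l | (forall j, 0 <= l 0 j) /\ \sum_j l 0 j = 1].

Lemma simplex_delta N (j : 'I_N) : simplex N (delta_mx 0 j).
Proof.
split=> [i|]; first by rewrite mxE eqxx /= ler0n.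
rewrite (bigD1 j)//= big1 ?addr0 => [|i /negbTE ij]; rewrite mxE ?eqxx//.
by rewrite ij andbF.
Qed.

Lemma simplex_conv N (l m : 'rV[R]_N) (t : R) : 0 <= t <= 1 ->
  simplex N l -> simplex N m -> simplex N ((1 - t) *: l + t *: m).
Proof.
move=> /andP[t0 t1] [l0 l1] [m0 m1]; split=> [j|].
  by rewrite !mxE addr_ge0// mulr_ge0// subr_ge0.
under eq_bigr do rewrite !mxE.
by rewrite big_split/= -!mulr_sumr l1 m1 !mulr1 subrK.
Qed.

Lemma continuous_sumr (T : topologicalType) (I : Type) (r : seq I)
    (f : I -> T -> R) :
  (forall i, continuous (f i)) -> continuous (fun x => \sum_(i <- r) f i x).
Proof.
move=> fc; elim: r => [|i r ih] x.
  under [X in continuous_at _ X]eq_fun do rewrite big_nil; exact: cvg_cst.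
under [X in continuous_at _ X]eq_fun do rewrite big_cons.
by apply: cvgD; [exact: fc|exact: ih].
Qed.

Lemma coord_continuousr N (j : 'I_N) :
  continuous (fun l : 'rV[R]_N => l 0 j : R).
Proof. exact: coord_continuous. Qed.

Lemma simplex_compact N : compact (simplex N).
Proof.
have cube := @rV_compact _ N (fun=> `[0, 1 : R]%classic)
  (fun=> @segment_compact R 0 1).
apply: (subclosed_compact _ cube); last first.
  move=> l [l0 l1] i /=; rewrite in_itv/= l0/= -l1 (bigD1 i)//= lerDl.
  by apply: sumr_ge0.
have -> : simplex N =
    \bigcap_(j in [set: 'I_N]) ((fun l : 'rV[R]_N => l 0 j) @^-1` [set x | 0 <= x])
    `&` (fun l : 'rV[R]_N => \sum_j l 0 j) @^-1` [set 1].
  apply/seteqP; split=> l [h1 h2]; split=> //= j; last exact: h1.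
  by move=> _; exact: h1.
apply: closedI.
  apply: closed_bigI => j _; apply: preimage_closed; last exact: closed_ge.
  by move=> x _; exact: coord_continuousr.
apply: preimage_closed; last exact: closed_eq.
by move=> x _; apply: continuous_sumr => j; exact: coord_continuousr.
Qed.

Context {N d : nat} (Y : 'M[R]_(N, d)).

(** Minimizing over weights instead of over the hull reduces existence to compactness of the simplex
    and continuity of a polynomial. *)
Lemma min_norm_exists : (0 < N)%N ->
  exists2 l, simplex N l & forall m, simplex N m ->
    dot (l *m Y) (l *m Y) <= dot (m *m Y) (m *m Y).
Proof.
move=> N0.
have [||l lS lmin] := @compact_EVT_min 'rV[R]_N R
    (fun l => dot (l *m Y) (l *m Y)) _ _ (@simplex_compact N).
- by exists (delta_mx 0 (Ordinal N0)); exact: simplex_delta.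
- have coordc i : continuous (fun l : 'rV[R]_N => (l *m Y) 0 i : R).
    have -> : (fun l : 'rV[R]_N => (l *m Y) 0 i) =
        (fun l => \sum_j l 0 j * Y j i).
      by apply/funext => l; rewrite mxE.
    apply: continuous_sumr => j x.
    apply: continuousM; first exact: coord_continuousr.
    exact: cst_continuous.
  apply: continuous_subspaceT; apply: continuous_sumr => i x.
  by apply: continuousM; exact: coordc.
- exists l => [|m mS]; first exact: set_mem.
  exact/lmin/mem_set.
Qed.

(* Moving from the minimizer [z] towards [y_i] must not decrease the norm. *)
Lemma min_norm_variational l : simplex N l ->
  (forall m, simplex N m -> dot (l *m Y) (l *m Y) <= dot (m *m Y) (m *m Y)) ->
  forall i, dot (l *m Y) (l *m Y) <= dot (l *m Y) (row i Y).
Proof.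
move=> lS lmin i; set z := l *m Y; set y := row i Y.
rewrite leNgt; apply/negP => lt.
have key (t : R) : 0 <= t <= 1 ->
    0 <= t * (t * dot (y - z) (y - z) - 2 * (dot z z - dot z y)).
  move=> t01; have := lmin _ (simplex_conv _ _ _ _ t01 lS (simplex_delta _ i)).
  rewrite mulmxDl -!scalemxAl -rowE -/z -/y.
  rewrite dot_subsq dotDl !dotDr !dotZl !dotZr (dotC y z).
  set a := dot z z; set b := dot z y; set c := dot y y => h.
  have : 0 <= (1 - t) * ((1 - t) * a) + (1 - t) * (t * b) +
    (t * ((1 - t) * b) + t * (t * c)) - a by rewrite subr_ge0.
  by congr (_ <= _); ring.
set D := dot (y - z) (y - z) in key; have D0 : 0 <= D by exact: dot_ge0.
set e := dot z z - dot z y in key; have e0 : 0 < e by rewrite subr_gt0.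
have De : 0 < D + e by lra.
(* This step size [t] satisfies [t * D <= e], whereas [key] forces [2 * e <= t * D]. The denominator
   [D + e] keeps [t] in the unit interval and stays positive even when [D = 0]. *)
have := key (e / (D + e)).
have t0 : 0 < e / (D + e) by rewrite divr_gt0.
have t1 : e / (D + e) <= 1 by rewrite ler_pdivrMr// mul1r lerDr.
rewrite (ltW t0) t1 => /(_ isT); rewrite pmulr_rge0// => h.
have : e / (D + e) * D <= e.
  rewrite mulrAC -mulrA ger_pMr// ler_pdivrMr// mul1r; lra.
lra.
Qed.

(** More than [d] rows of length [d] admit a nonzero left kernel vector; the selection matrix [P]
    pads it with zeros outside [B]. *)
Lemma linear_dependence (B : {set 'I_N}) : (d < #|B|)%N ->
  exists2 m : 'rV[R]_N, m != 0 &
    m *m Y = 0 /\ (forall j, j \notin B -> m 0 j = 0).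
Proof.
move=> dB; pose Z := rowsub (enum_val : 'I_#|B| -> 'I_N) Y.
have : kermx Z != 0.
  rewrite kermx_eq0 /row_free; apply: contraTneq dB => rZ.
  by rewrite -leqNgt -rZ rank_leq_col.
move=> /rowV0Pn[u /sub_kermxP uZ u0].
pose P : 'M[R]_(#|B|, N) := rowsub enum_val 1%:M.
have PZ : P *m Y = Z by rewrite mul_rowsub_mx mul1mx.
exists (u *m P); last first.
  split=> [|j jB]; first by rewrite -mulmxA PZ uZ.
  rewrite mxE big1// => k _; rewrite !mxE.
  case: eqP => [kj|_]; last by rewrite mulr0.
  by move: jB; rewrite -kj enum_valP.
apply: contraNneq u0 => uP0; apply/eqP/rowP => k.
have := congr1 (fun m : 'rV_N => m 0 (enum_val k)) uP0.
rewrite !mxE (bigD1 k)//= big1 ?addr0 => [|k' k'k]; rewrite !mxE.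
  by rewrite eqxx mulr1.
by rewrite (inj_eq enum_val_inj) (negbTE k'k) mulr0.
Qed.

Definition support_set (l : 'rV[R]_N) : {set 'I_N} := [set j | l 0 j != 0].

(* The carrier points lie on the hyperplane [<z, .> = |z|^2], so any linear
   dependence between them is an affine one: [d] points suffice. *)
Lemma caratheodory_face (z : 'rV[R]_d) l : simplex N l -> l *m Y = z ->
  z != 0 -> (forall i, dot z z <= dot z (row i Y)) ->
  exists m, [/\ simplex N m, m *m Y = z & (#|support_set m| <= d)%N].
Proof.
move=> lS lz z0 zmin.
have [k] := ubnP #|support_set l|.
elim: k => // k ih in l lS lz *.
rewrite ltnS => lk; have [|ld] := leqP #|support_set l| d.
  by exists l.
have [m m0 [mY mB]] := linear_dependence _ ld.
(* The slacks [dot z (row i Y) - dot z z] are nonnegative and their average under [l] is zero, so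
   they vanish wherever [l] does not. *)
have tight j : j \in support_set l -> dot (row j Y) z = dot z z.
  move=> jB; have : \sum_i l 0 i * (dot z (row i Y) - dot z z) == 0.
    under eq_bigr do rewrite mulrBr (dotC z (row _ _)).
    by rewrite sumrB -dot_mulmxl lz -mulr_suml lS.2 mul1r subrr.
  rewrite psumr_eq0 => [/allP/(_ j (mem_index_enum _))/=|i _]; last first.
    by rewrite mulr_ge0 ?subr_ge0//; exact: lS.1.
  by rewrite mulf_eq0; move: jB; rewrite inE => /negbTE -> /=;
    rewrite subr_eq0 dotC => /eqP.
(* By tightness, pairing [m *m Y = 0] with [z] gives [dot z z] times the sum of [m], and [z] is
   nonzero. *)
have m_sum : \sum_j m 0 j = 0.
  have : dot (m *m Y) z = 0.
    by rewrite mY /dot big1// => i _; rewrite mxE mul0r.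
  rewrite dot_mulmxl (eq_bigr (fun j => m 0 j * dot z z)); last first.
    move=> j _; have [jB|/mB ->] := boolP (j \in support_set l).
      by rewrite tight.
    by rewrite !mul0r.
  rewrite -mulr_suml => /eqP; rewrite mulf_eq0 dot_eq0 (negbTE z0) orbF.
  by move=> /eqP.
have [j0 mj0] : exists j, 0 < m 0 j.
  apply: contrapT => npos; move/negP: m0; apply; apply/eqP/rowP => j.
  have mle i : 0 <= - m 0 i.
    by rewrite oppr_ge0 leNgt; apply/negP => mi; apply: npos; exists i.
  have : \sum_i - m 0 i == 0 by rewrite sumrN m_sum oppr0.
  rewrite psumr_eq0 => [/allP/(_ j (mem_index_enum _))/=|i _ //].
  by rewrite oppr_eq0 mxE => /eqP.
(* Ratio test: the smallest ratio over positive entries of [m] is the largest [t] for which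
   [l - t *: m] stays nonnegative, and it cancels the minimizing entry. *)
pose r j := l 0 j / m 0 j.
case: (@Order.TotalTheory.arg_minP _ R _ j0 (fun j => 0 < m 0 j) r mj0) => j mj rmin.
set t := r j; have t0 : 0 <= t by rewrite divr_ge0 ?(ltW mj)//; exact: lS.1.
have [|||] := ih (l - t *: m); last by move=> p [pS pz pd]; exists p.
- split=> [i|].
    rewrite !mxE subr_ge0; have [mi|mi] := ltP 0 (m 0 i).
      by rewrite -ler_pdivlMr//; exact: rmin.
    by rewrite (le_trans _ (lS.1 i))// mulr_ge0_le0.
  under eq_bigr do rewrite !mxE.
  by rewrite sumrB -mulr_sumr m_sum mulr0 subr0 lS.2.
- by rewrite mulmxBl -scalemxAl lz mY scaler0 subr0.
- apply: leq_trans lk; apply: proper_card; apply/properP; split.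
    apply/fintype.subsetP => i; rewrite !inE !mxE; apply: contraNneq => li.
    by rewrite li mB ?inE ?li ?eqxx// mulr0 subr0.
  exists j; rewrite !inE.
    apply: contraTneq mj => lj; rewrite mB ?ltxx//.
    by rewrite inE lj eqxx.
  by rewrite !mxE negbK /t /r divfK ?subrr// gt_eqF.
Qed.

End MinimalNorm.

(** * The nearest point of a subfamily: uniqueness, locality and small bases *)

Section NearestPoint.
Context {R : realType} {N d : nat}.
Implicit Types (Y : 'M[R]_(N, d)) (S : {set 'I_N}).

Definition enorm_rv (u : 'rV[R]_d) : R := Num.sqrt (dot u u).

(* [z] is the point of least norm in the convex hull of the rows of [Y] indexed
   by [S], expressed through its variational characterization. *)
Definition is_nearest Y S (z : 'rV[R]_d) : Prop :=
  (exists l, [/\ simplex N l, support_set l \subset S & l *m Y = z]) /\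
  (forall i, i \in S -> dot z z <= dot z (row i Y)).

(** The default [0] covers sets such as the empty one, whose hull has no point; it is harmless,
    since a zero vector separates nothing in the counting below. *)
Definition nearest Y S : 'rV[R]_d := xget 0 [set z | is_nearest Y S z].

Lemma is_nearest_dot Y S z z' :
  is_nearest Y S z -> is_nearest Y S z' -> dot z z <= dot z z'.
Proof.
move=> [_ zmin] [[l [[l0 l1] lS lz]] _].
rewrite (dotC z z') -lz dot_mulmxl -[leLHS]mul1r -l1 mulr_suml.
apply: ler_sum => j _; have [lj|lj] := eqVneq (l 0 j) 0; first by rewrite lj !mul0r.
rewrite ler_wpM2l// (dotC _ z) zmin//.
by move/fintype.subsetP: lS; apply; rewrite inE.
Qed.

(** The variational inequalities bound both squared norms by [dot z z'], so the squared distance of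
    [z] and [z'] is at most zero. *)
Lemma is_nearest_uniq Y S z z' :
  is_nearest Y S z -> is_nearest Y S z' -> z = z'.
Proof.
move=> h h'; have := is_nearest_dot _ _ _ _ h h'.
have := is_nearest_dot _ _ _ _ h' h; rewrite dotC => le' le.
apply/eqP; rewrite -subr_eq0 -dot_eq0 eq_le dot_ge0 andbT dot_subsq; lra.
Qed.

Lemma nearestE Y S z : is_nearest Y S z -> nearest Y S = z.
Proof.
by move=> h; apply: xget_unique => // z' h'; exact: (is_nearest_uniq _ _ _ _ h').
Qed.

Lemma is_nearest_local Y Y' S z : (forall i, i \in S -> row i Y = row i Y') ->
  is_nearest Y S z -> is_nearest Y' S z.
Proof.
move=> YY' [[l [ls lS lz]] zmin]; split; last by move=> i iS; rewrite -YY'// zmin.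
exists l; split=> //; rewrite -lz; apply/rowP => k; rewrite !mxE.
apply: eq_bigr => j _; have [->|lj] := eqVneq (l 0 j) 0; first by rewrite !mul0r.
have jS : j \in S by move/fintype.subsetP: lS; apply; rewrite inE.
by have /rowP/(_ k) := YY' _ jS; rewrite !mxE => ->.
Qed.

(** In the counting argument this replaces conditioning: the halfspace cut out by [S] does not see
    the points outside [S]. *)
Lemma nearest_local Y Y' S : (forall i, i \in S -> row i Y = row i Y') ->
  nearest Y S = nearest Y' S.
Proof.
move=> h; congr xget; apply/seteqP; split=> z /=; apply: is_nearest_local => //.
by move=> i iS; rewrite h.
Qed.

Lemma nearestP Y : (0 < N)%N ->
  is_nearest Y [set: 'I_N]%SET (nearest Y [set: 'I_N]%SET).
Proof.
move=> N0; have [l lS lmin] := min_norm_exists Y N0.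
have h : is_nearest Y [set: 'I_N]%SET (l *m Y).
  split; first by exists l; split=> //; exact: finset.subsetT.
  by move=> i _; exact: min_norm_variational.
by rewrite (nearestE _ _ _ h).
Qed.

(** [B] is the support of a reduced representation of the global nearest point [z]. If [S] contains
    [B], then [z] lies in the hull of [S] and still satisfies the variational inequality there, so
    uniqueness applies. *)
Lemma nearest_basis Y : (0 < N)%N -> nearest Y [set: 'I_N]%SET != 0 ->
  exists2 B : {set 'I_N}, (#|B| <= d)%N &
    forall S, B \subset S -> nearest Y S = nearest Y [set: 'I_N]%SET.
Proof.
move=> N0; have [[l [lS _ lz]] zmin] := nearestP Y N0.
set z := nearest Y [set: 'I_N]%SET in lz zmin * => z0.
have zmin' i : dot z z <= dot z (row i Y) by apply: zmin; rewrite inE.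
have [m [mS mz md]] := caratheodory_face _ _ _ lS lz z0 zmin'.
exists (support_set m) => // S BS; apply: nearestE; split; first by exists m.
by move=> i _.
Qed.

End NearestPoint.

(** * Weighted double counting on a finite product space *)

Section DoubleCounting.
Context {R : realType} {N : nat} {G : finType}.
Variables (w : G -> R) (b : R).
Hypothesis w_ge0 : forall g, 0 <= w g.
Hypothesis w_sum : \sum_g w g = 1.
Hypothesis b_ge0 : 0 <= b.

(** Under the product weight, fixing the coordinates outside [K] fixes the predicate [a x]; the
    coordinates in [K] remain independent and each contributes a factor at most [b]. *)
Lemma sum_prod_cond (K : {set 'I_N}) (a : {ffun 'I_N -> G} -> pred G) :
  (forall x y : {ffun 'I_N -> G},
     (forall i, i \notin K -> x i = y i) -> a x = a y) ->
  (forall x, \sum_(g | a x g) w g <= b) ->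
  \sum_(x : {ffun 'I_N -> G} | [forall i in K, a x (x i)]) \prod_i w (x i)
    <= b ^+ #|K|.
Proof.
move=> aK ab.
have [g0 _] : exists g : G, True.
  apply: contrapT => G0; have := oner_neq0 R; rewrite -w_sum big1 ?eqxx// => g.
  by case: G0; exists g.
(* Overwriting the coordinates in [K] by [g0] makes the fibers of [r] the classes of configurations
   that agree outside [K]. *)
pose r (x : {ffun 'I_N -> G}) := [ffun i => if i \in K then g0 else x i].
rewrite (partition_big r predT)//=.
pose H (y : {ffun 'I_N -> G}) (i : 'I_N) (g : G) :=
  if i \in K then w g * (a y g)%:R else w g * (g == y i)%:R.
have step y : \sum_(x : {ffun 'I_N -> G} | [forall i in K, a x (x i)] && (r x == y))
    \prod_i w (x i) <= \prod_i \sum_g H y i g.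
  rewrite bigA_distr_bigA/= big_mkcond/=; apply: ler_sum => x _.
  have H0 : 0 <= \prod_i H y i (x i).
    apply: prodr_ge0 => i _; rewrite /H.
    by case: ifP => _; rewrite mulr_ge0// ler0n.
  case: ifP => // /andP[/forall_inP ax /eqP rx].
  rewrite le_eqVlt; apply/orP; left; apply/eqP; apply: eq_bigr => i _.
  rewrite /H; case: ifPn => iK.
    rewrite -(aK x y) ?ax ?mulr1// => j jK.
    by rewrite -rx ffunE (negbTE jK).
  by rewrite -rx ffunE (negbTE iK) eqxx mulr1.
(* A point mass at [g0] on [K] and [w] elsewhere: each factor has total mass 1, so summing the fiber
   bounds over [y] leaves [b ^+ #|K|]. Fibers over a [y] that differs from [g0] somewhere on [K] are
   empty. *)
pose H' (i : 'I_N) (g : G) := if i \in K then (g == g0)%:R else w g.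
have bound y : \sum_(x : {ffun 'I_N -> G} | [forall i in K, a x (x i)] && (r x == y))
    \prod_i w (x i) <= b ^+ #|K| * \prod_i H' i (y i).
  have [yK|yK] := boolP [forall i in K, y i == g0]; last first.
    rewrite [leLHS]big_pred0 => [|x].
      rewrite mulr_ge0 ?exprn_ge0// prodr_ge0// => i _; rewrite /H'.
      by case: ifP; rewrite ?ler0n.
    apply/negP => /andP[_ /eqP rx]; move/negP: yK; apply.
    by apply/forall_inP => i iK; rewrite -rx ffunE iK.
  apply: le_trans (step y) _.
  rewrite -prodr_const [X in X * _]big_mkcond -big_split/=.
  apply: ler_prod => i _; apply/andP; split.
    by apply: sumr_ge0 => g _; rewrite /H; case: ifP => _; rewrite mulr_ge0// ler0n.
  rewrite /H /H'; case: ifPn => iK.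
    move/forall_inP: yK => /(_ _ iK) ->; rewrite mulr1.
    apply: le_trans (ab y); rewrite [leRHS]big_mkcond/=; apply: ler_sum => g _.
    by case: ifP; rewrite ?mulr1 ?mulr0.
  rewrite mul1r (bigD1 (y i))//= eqxx mulr1 big1 ?addr0// => g /negbTE ->.
  by rewrite mulr0.
apply: le_trans (ler_sum _ (fun y _ => bound y)) _.
rewrite -mulr_sumr -(bigA_distr_bigA H') big1 ?mulr1// => i _.
rewrite /H'; case: (i \in K) => //.
by rewrite (bigD1 g0)//= eqxx big1 ?addr0// => g /negbTE ->.
Qed.

Context {d : nat} (v : G -> 'rV[R]_d) (eps : R).
Hypothesis eps_ge0 : 0 <= eps.
Hypothesis halfspace_le : forall c : 'rV[R]_d, c != 0 ->
  \sum_(g | eps * enorm_rv c < dot c (v g)) w g <= b.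

Definition config (x : {ffun 'I_N -> G}) : 'M[R]_(N, d) := \matrix_i v (x i).

Definition separates (c : 'rV[R]_d) (g : G) : bool :=
  (c != 0) && (eps * enorm_rv c < dot c (v g)).

(** Every [k]-subset [K] of the complement of a basis [B] is counted: [~: K] contains [B], so its
    nearest point is [z], and each sample point satisfies
    [dot z y >= dot z z > eps * enorm_rv z]. *)
Lemma far_count (k : nat) (x : {ffun 'I_N -> G}) : (0 < N)%N ->
  eps < enorm_rv (nearest (config x) [set: 'I_N]%SET) ->
  ('C(N - d, k) <= #|[set K : {set 'I_N} | (#|K| == k) &&
     [forall i in K, separates (nearest (config x) (~: K)) (x i)]]%SET|)%N.
Proof.
move=> N0; set z := nearest _ _ => zeps.
have z_gt0 : 0 < enorm_rv z by exact: le_lt_trans zeps.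
have z0 : z != 0.
  apply: contraTneq z_gt0 => ->.
  by rewrite /enorm_rv (eqP (_ : dot 0 0 == 0)) ?dot_eq0// sqrtr0 ltxx.
have [B Bd BS] := nearest_basis _ N0 z0.
apply: (@leq_trans 'C(#|~: B|, k)).
  by apply: leq_bin2l; rewrite cardsCs card_ord finset.setCK leq_sub2l.
rewrite -cards_draws; apply: subset_leq_card; apply/fintype.subsetP => K.
rewrite !inE => /andP[KB ->] /=; apply/forall_inP => i iK.
rewrite BS -/z; last by rewrite -finset.setCS finset.setCK.
rewrite /separates z0 /=.
have [_ /(_ i)] := nearestP (config x) N0; rewrite inE => /(_ isT).
rewrite rowK -/z; apply: lt_le_trans.
by rewrite -[ltRHS]sqr_sqrtr ?dot_ge0// expr2 ltr_pM2r.
Qed.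

(** Both sides estimate the weighted number of pairs [(x, K)] in which all points of [K] are
    separated: from below for each far [x], from above for each [K]. *)
Lemma sum_far_le (k : nat) : (0 < N)%N ->
  (\sum_(x : {ffun 'I_N -> G} |
      eps < enorm_rv (nearest (config x) [set: 'I_N]%SET)) \prod_i w (x i))
    * 'C(N - d, k)%:R <= 'C(N, k)%:R * b ^+ k.
Proof.
move=> N0.
pose A (x : {ffun 'I_N -> G}) (K : {set 'I_N}) :=
  [forall i in K, separates (nearest (config x) (~: K)) (x i)].
apply: (@le_trans _ _
    (\sum_(K : {set 'I_N} | #|K| == k) \sum_(x | A x K) \prod_i w (x i))).
  rewrite mulr_suml (exchange_big_dep predT)//= big_mkcond/=.
  apply: ler_sum => x _.
  have pw0 : 0 <= \prod_i w (x i) by apply: prodr_ge0.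
  case: ifPn => [far|_]; last by apply: sumr_ge0.
  rewrite sumr_const -[leRHS]mulr_natr ler_wpM2l// ler_nat.
  apply: leq_trans (far_count k x N0 far) _.
  by rewrite cardsE.
apply: (@le_trans _ _ (\sum_(K : {set 'I_N} | #|K| == k) b ^+ k)).
  apply: ler_sum => K /eqP <-.
  apply: (@sum_prod_cond K (fun x => separates (nearest (config x) (~: K)))).
    move=> x y xy; congr separates; apply: nearest_local => i.
    by rewrite inE !rowK => /xy ->.
  move=> x; set c := nearest _ _; have [c0|c0] := eqVneq c 0.
    by rewrite big_pred0// => g; rewrite /separates c0 eqxx.
  by rewrite /separates c0; exact: halfspace_le.
rewrite sumr_const -[leLHS]mulr_natl -cardsE.
by rewrite card_draws card_ord.
Qed.

End DoubleCounting.

(** * Binomial ratios and the geometric decay of the bound *)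

Section Numerics.
Local Open Scope nat_scope.

(** Consecutive binomials have ratio [M / (M - k)], which is at most 5/2 under the hypothesis. *)
Lemma bin_ratio_step M k : 0 < k -> 5 * k <= 3 * M ->
  2 * 'C(M, k) <= 5 * 'C(M.-1, k).
Proof.
move=> k0 kM; have Mk : 0 < M - k by lia.
have h : 2 * M <= 5 * (M - k) by lia.
have := mul_bin_down M k; rewrite -(leq_pmul2l Mk).
move: (M - k) ('C(M, k)) ('C(M.-1, k)) h => q C C' h e.
have -> : q * (2 * C) = 2 * M * C' by rewrite mulnCA -e mulnA.
have -> : q * (5 * C') = 5 * q * C' by rewrite mulnCA mulnA.
by rewrite leq_mul2r h orbT.
Qed.

(** The one-step bound is iterated [d] times; it stays applicable because
    [5 * k + 3 * d <= 6 * k <= 3 * N]. *)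
Lemma bin_ratio N d k : 3 * d <= k -> 2 * k <= N ->
  2 ^ d * 'C(N, k) <= 5 ^ d * 'C(N - d, k).
Proof.
elim: d => [|d ih] dk kN; first by rewrite subn0.
have {}ih : 2 ^ d * 'C(N, k) <= 5 ^ d * 'C(N - d, k) by apply: ih => //; lia.
rewrite !expnS -mulnA (leq_trans (leq_mul (leqnn 2) ih))//.
rewrite mulnCA (mulnC 5) -mulnA leq_mul2l subnS bin_ratio_step ?orbT//; lia.
Qed.

End Numerics.

(** With [a = 3 / (4 * n)], Bernoulli's inequality gives [(1 + a) ^+ n >= 7 / 4], while
    [b * (1 + a) <= (1 - a) * (1 + a) <= 1]. *)
Lemma expr_contract_le (R : realType) (b : R) n : (0 < n)%N -> 0 <= b ->
  b <= 1 - 3 / (4 * n%:R) -> b ^+ n <= 4 / 7.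
Proof.
move=> n0 b0 bn; have nR : 0 < n%:R :> R by rewrite ltr0n.
set a := 3 / (4 * n%:R) in bn; have a0 : 0 < a by rewrite divr_gt0// mulr_gt0.
have an : n%:R * a = 3 / 4 by rewrite /a; field; rewrite gt_eqF.
have bern m : 1 + m%:R * a <= (1 + a) ^+ m.
  elim: m => [|m ih]; first by rewrite expr0 mul0r addr0.
  rewrite exprS -natr1.
  have : (1 + a) * (1 + m%:R * a) <= (1 + a) * (1 + a) ^+ m.
    by rewrite ler_wpM2l//; lra.
  apply: le_trans; have m0 : 0 <= m%:R :> R by [].
  nra.
have h : b ^+ n * (1 + a) ^+ n <= 1.
  rewrite -exprMn exprn_ile1//; first by apply: mulr_ge0 => //; lra.
  nra.
have := bern n; rewrite an => h2.
have bn0 : 0 <= b ^+ n by rewrite exprn_ge0.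
nra.
Qed.

(** The binomial ratio costs at most (5/2)^d, and [x = b ^+ (3 * n)] is at most (4/7)^3 = 64/343 <
    1/5. Hence [p] is at most (5x/2)^d, strictly below 2^-d because [d] is positive. *)
Lemma bin_expr_lt (R : realType) (p b : R) (d n N : nat) :
  (0 < d)%N -> (1 < n)%N -> (6 * d * n <= N)%N ->
  0 <= b -> b <= 1 - 3 / (4 * n%:R) ->
  p * 'C(N - d, 3 * d * n)%:R <= 'C(N, 3 * d * n)%:R * b ^+ (3 * d * n) ->
  p < 2 ^- d.
Proof.
move=> d0 n1 dnN b0 bn; set k := (3 * d * n)%N => hp.
have dk : (3 * d <= k)%N by rewrite /k leq_pmulr//; lia.
have kN : (2 * k <= N)%N by rewrite /k; lia.
have C0 : 0 < 'C(N - d, k)%:R :> R by rewrite ltr0n bin_gt0; lia.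
have ratio : 2 ^+ d * 'C(N, k)%:R <= 5 ^+ d * 'C(N - d, k)%:R :> R.
  by rewrite -!natrX -!natrM ler_nat bin_ratio.
pose x := b ^+ (3 * n); have x0 : 0 <= x by rewrite exprn_ge0.
have x5 : 5 * x < 1.
  have := expr_contract_le _ _ _ (ltnW n1) b0 bn.
  have : 0 <= b ^+ n by rewrite exprn_ge0.
  rewrite /x mulnC exprM; move: (b ^+ n) => y y0 y47.
  have y2 : y * y <= 16 / 49 by nra.
  have y3 : y * (y * y) <= y * (16 / 49) by rewrite ler_wpM2l.
  rewrite exprS expr2; lra.
have bk : b ^+ k = x ^+ d by rewrite /k /x mulnAC exprM.
rewrite -[ltRHS]mul1r ltr_pdivlMr ?exprn_gt0//.
apply: (@le_lt_trans _ _ ((5 * x) ^+ d)); last first.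
  by rewrite exprn_ilt1 ?mulr_ge0 -?lt0n.
rewrite -(ler_pM2r C0).
apply: (@le_trans _ _ (2 ^+ d * 'C(N, k)%:R * b ^+ k)).
  by rewrite mulrAC mulrC -mulrA ler_wpM2l// exprn_ge0.
rewrite bk exprMn [leRHS]mulrAC ler_wpM2r// exprn_ge0//.
Qed.

(** * Euclidean norm, convex hulls and distance to the origin *)

Section EuclideanNorm.
Context {R : realType} {d : nat}.
Implicit Types u v : 'rV[R]_d.

Lemma enorm_rv_ge0 u : 0 <= enorm_rv u.
Proof. exact: sqrtr_ge0. Qed.

Lemma enorm_rv_sqr u : enorm_rv u ^+ 2 = dot u u.
Proof. by rewrite sqr_sqrtr ?dot_ge0. Qed.

Lemma enorm_rv_eq0 u : (enorm_rv u == 0) = (u == 0).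
Proof. by rewrite -dot_eq0 -enorm_rv_sqr expf_eq0. Qed.

Lemma enorm_rv0 : enorm_rv (0 : 'rV[R]_d) = 0.
Proof. by apply/eqP; rewrite enorm_rv_eq0. Qed.

Lemma enorm_rvZ a u : enorm_rv (a *: u) = `|a| * enorm_rv u.
Proof.
by rewrite /enorm_rv dotZl dotZr mulrA -expr2 sqrtrM ?sqr_ge0// sqrtr_sqr.
Qed.

(** For [a] and [b] the norms of [u] and [v], the squared norm of [b *: u - a *: v] equals
    [2 * a * b * (a * b - dot u v)]. *)
Lemma cauchy_schwarz u v : dot u v <= enorm_rv u * enorm_rv v.
Proof.
set a := enorm_rv u; set b := enorm_rv v.
have a0 : 0 <= a := enorm_rv_ge0 _; have b0 : 0 <= b := enorm_rv_ge0 _.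
have [/eqP|u0] := eqVneq a 0.
  rewrite enorm_rv_eq0 => /eqP ->.
  by rewrite /dot big1 ?mulr_ge0// => i _; rewrite mxE mul0r.
have [/eqP|v0] := eqVneq b 0.
  rewrite enorm_rv_eq0 => /eqP ->.
  by rewrite /dot big1 ?mulr_ge0// => i _; rewrite mxE mulr0.
have := dot_ge0 (b *: u - a *: v).
rewrite dot_subsq !dotZl !dotZr -!enorm_rv_sqr -/a -/b => h.
have ab : 0 < a * b by rewrite mulr_gt0// lt_neqAle eq_sym ?u0 ?v0.
rewrite -(ler_pM2l ab); nra.
Qed.

Lemma enorm_rvD u v : enorm_rv (u + v) <= enorm_rv u + enorm_rv v.
Proof.
rewrite -ler_sqr ?nnegrE ?addr_ge0 ?enorm_rv_ge0//.
rewrite enorm_rv_sqr dotDl !dotDr (dotC v u) -!enorm_rv_sqr.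
have := cauchy_schwarz u v; nra.
Qed.

Lemma enorm_rv_mulmx N (l : 'rV[R]_N) (Y : 'M[R]_(N, d)) :
  enorm_rv (l *m Y) <= \sum_j `|l 0 j| * enorm_rv (row j Y).
Proof.
rewrite mulmx_sum_row; elim/big_ind2: _ => [||j _]; first by rewrite enorm_rv0.
  by move=> u a v b ua vb; apply: le_trans (enorm_rvD _ _) _; exact: lerD.
by rewrite enorm_rvZ.
Qed.

Lemma enorm_rv_le_sum u : enorm_rv u <= \sum_i `|u 0 i|.
Proof.
rewrite -[u in leLHS]mulmx1; apply: le_trans (enorm_rv_mulmx _ _ _) _.
apply: ler_sum => i _; rewrite row1 /enorm_rv /dot (bigD1 i)//= big1.
  by rewrite !mxE !eqxx /= mulr1 addr0 sqrtr1 mulr1.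
by move=> j /negbTE ji; rewrite !mxE ji andbF mul0r.
Qed.

Lemma coord_le_enorm_rv u i : `|u 0 i| <= enorm_rv u.
Proof.
rewrite -sqrtr_sqr ler_wsqrtr// /dot (bigD1 i)//= expr2 lerDl.
by apply: sumr_ge0 => j _; rewrite -expr2 sqr_ge0.
Qed.

Definition row_of (x : d.-tuple R) : 'rV[R]_d := \row_i tnth x i.

Lemma enormE x : enorm x = enorm_rv (row_of x).
Proof.
congr Num.sqrt; apply: eq_bigr => i _.
by rewrite !mxE tnth_mktuple subr0 expr2.
Qed.

Lemma edist0E x : Defs.edist (zero_vec R d) x = enorm_rv (row_of x).
Proof.
congr Num.sqrt; apply: eq_bigr => i _.
by rewrite !mxE tnth_mktuple sub0r sqrrN expr2.
Qed.

(** A convex combination may have any length and repeat points; choosing an index for each term and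
    adding the weights with equal index gives one weight per sample point. *)
Lemma conv_hull_rangeE N (p : 'I_N -> d.-tuple R) (x : d.-tuple R) :
  conv_hull [set p k | k in [set: 'I_N]] x <->
  exists2 l, simplex N l & row_of x = l *m \matrix_k row_of (p k).
Proof.
split=> [[m [q [lam [qp lam0 lam1 xE]]]]|[l [l0 l1] xE]]; last first.
  exists N, p, (l 0); split=> [j|||i]; [by exists j|by []|by []|].
  have := congr1 (fun u : 'rV_d => u 0 i) xE; rewrite !mxE => ->.
  by apply: eq_bigr => k _; rewrite !mxE.
have /boolp.choice[f fE] : forall j, exists k, p k = q j.
  by move=> j; have [k _ <-] := qp j; exists k.
exists (\row_k \sum_(j | f j == k) lam j).
  split=> [k|]; first by rewrite mxE sumr_ge0.
  by under eq_bigr do rewrite mxE; rewrite -lam1 (partition_big f predT).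
apply/rowP => i; rewrite !mxE xE (partition_big f predT)//=.
apply: eq_bigr => k _; rewrite !mxE mulr_suml.
by apply: eq_bigr => j /eqP <-; rewrite fE.
Qed.

Lemma dist_set_le_enorm N (p : 'I_N -> d.-tuple R) (r : R) (l : 'rV[R]_N) :
  simplex N l -> enorm_rv (l *m \matrix_k row_of (p k)) <= r ->
  dist_set (zero_vec R d) (conv_hull [set p k | k in [set: 'I_N]]) <= r.
Proof.
move=> lS; apply: le_trans; apply: inf_lbound.
  by exists 0 => _ [x _ <-]; exact: sqrtr_ge0.
set z := l *m _.
have rz : row_of [tuple z 0 i | i < d] = z.
  by apply/rowP => i; rewrite !mxE tnth_mktuple !mxE.
exists [tuple z 0 i | i < d]; last by rewrite edist0E rz.
by apply/conv_hull_rangeE; exists l.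
Qed.

Lemma dist_set_leP N (p : 'I_N -> d.-tuple R) (r : R) : (0 < N)%N ->
  dist_set (zero_vec R d) (conv_hull [set p k | k in [set: 'I_N]]) <= r <->
  forall j : nat, exists2 l, simplex N l &
    enorm_rv (l *m \matrix_k row_of (p k)) < r + j.+1%:R^-1.
Proof.
move=> N0; split=> [dr j|h].
  have [] := @inf_adherent R _ (j.+1%:R^-1) _
    (_ : has_inf [set Defs.edist (zero_vec R d) a
      | a in conv_hull [set p k | k in [set: 'I_N]]]).
  - by rewrite invr_gt0.
  - split; last by exists 0 => _ [x _ <-]; exact: sqrtr_ge0.
    pose x := p (Ordinal N0); exists (Defs.edist (zero_vec R d) x), x => //.
    apply/conv_hull_rangeE; exists (delta_mx 0 (Ordinal N0)).
      exact: simplex_delta.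
    by rewrite -rowE rowK.
  move=> _ [x /conv_hull_rangeE[l lS xE] <-]; rewrite edist0E xE => lt.
  by exists l => //; apply: lt_le_trans lt _; rewrite lerD2r.
apply/ler_addgt0Pr => e e0.
have [j je] : exists j : nat, j.+1%:R^-1 < e.
  by exists (Num.truncn e^-1); rewrite invf_plt ?posrE// truncnS_gt.
have [l lS lt] := h j; apply: (dist_set_le_enorm _ _ _ _ lS).
by apply: le_trans (ltW lt) _; rewrite lerD2l ltW.
Qed.

(* Strictness makes the weights [a] automatically nonzero, and homogeneity
   spares normalizing them. *)
Lemma simplex_natP N (Y : 'M[R]_(N, d)) (q : R) :
  (exists2 l, simplex N l & enorm_rv (l *m Y) < q) <->
  exists a : {ffun 'I_N -> nat},
    enorm_rv ((\row_k (a k)%:R) *m Y) < q * (\sum_k a k)%:R.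
Proof.
split=> [[l [l0 l1] lq]|[a aq]]; last first.
  have s0 : 0 < (\sum_k a k)%:R :> R.
    rewrite ltr0n lt0n; apply: contraTneq aq => ->.
    by rewrite mulr0 -leNgt enorm_rv_ge0.
  exists ((\sum_k a k)%:R^-1 *: \row_k (a k)%:R).
    split=> [k|]; first by rewrite !mxE mulr_ge0 ?invr_ge0.
    rewrite (eq_bigr (fun k => (\sum_k a k)%:R^-1 * (a k)%:R)) => [|k _].
      by rewrite -mulr_sumr -natr_sum mulVf// gt_eqF.
    by rewrite !mxE.
  rewrite -scalemxAl enorm_rvZ ger0_norm ?invr_ge0 ?ler0n//.
  by rewrite mulrC ltr_pdivrMr.
set q' := enorm_rv _ in lq; have q'0 : 0 <= q' := enorm_rv_ge0 _.
set C := \sum_j enorm_rv (row j Y).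
have C0 : 0 <= C by apply: sumr_ge0 => j _; exact: enorm_rv_ge0.
(* Rounding [L *: l] down moves each weight by at most 1. This adds at most [C] to the norm and
   removes at most [q * N%:R] on the right; [L] is large enough for [L * (q - q')] to absorb
   both. *)
pose L : R := (Num.truncn ((C + q * N%:R) / (q - q'))).+1%:R.
have Lgt : C + q * N%:R < L * (q - q').
  by rewrite -ltr_pdivrMr ?subr_gt0// truncnS_gt.
have L0 : 0 <= L by rewrite ler0n.
pose a := [ffun k => Num.truncn (L * l 0 k)].
have ale k : (a k)%:R <= L * l 0 k by rewrite ffunE truncn_le ?mulr_ge0.
have agt k : L * l 0 k - (a k)%:R <= 1.
  by rewrite lerBlDl natr1 ffunE ltW// truncnS_gt.
exists a.
have sa : L - N%:R <= (\sum_k a k)%:R.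
  rewrite natr_sum lerBlDl -lerBlDr.
  have -> : L - \sum_k (a k)%:R = \sum_k (L * l 0 k - (a k)%:R).
    by rewrite sumrB -mulr_sumr l1 mulr1.
  apply: le_trans (ler_sum _ (fun k _ => agt k)) _.
  by rewrite sumr_const card_ord.
have aY : enorm_rv ((\row_k (a k)%:R) *m Y) <= L * q' + C.
  have -> : \row_k (a k)%:R = L *: l + (\row_k ((a k)%:R - L * l 0 k)).
    by apply/rowP => k; rewrite !mxE addrC subrK.
  rewrite mulmxDl; apply: le_trans (enorm_rvD _ _) _; apply: lerD.
    by rewrite -scalemxAl enorm_rvZ ger0_norm.
  apply: le_trans (enorm_rv_mulmx _ _ _) _; apply: ler_sum => k _.
  rewrite mxE distrC ger0_norm ?subr_ge0// -[leRHS]mul1r.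
  by rewrite ler_wpM2r ?enorm_rv_ge0.
have : q * (L - N%:R) <= q * (\sum_k a k)%:R by rewrite ler_wpM2l//; lra.
lra.
Qed.

End EuclideanNorm.

(** * Measurability of the distance event *)

Section Measurability.
Context {R : realType} {dT : measure_display} {T : measurableType dT} {d : nat}.

Lemma measurable_enorm_rv (f : T -> 'rV[R]_d) :
  (forall i, measurable_fun setT (fun w => f w 0 i)) ->
  measurable_fun setT (fun w => enorm_rv (f w)).
Proof.
move=> mf; apply: (@measurableT_comp _ _ _ _ _ _ (@Num.sqrt R)).
  by apply: continuous_measurable_fun; exact: sqrt_continuous.
by apply: measurable_sum => i; exact: measurable_funM.
Qed.

Lemma measurable_coord (X : T -> d.-tuple R) i : random_vector X ->
  measurable_fun setT (fun w => tnth (X w) i).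
Proof.
by move=> mX; apply: (measurableT_comp (measurable_tnth i)).
Qed.

Lemma measurable_enorm (X : T -> d.-tuple R) : random_vector X ->
  measurable_fun setT (fun w => enorm (X w)).
Proof.
move=> mX; under eq_fun do rewrite enormE.
apply: measurable_enorm_rv => i; under eq_fun do rewrite mxE.
exact: measurable_coord.
Qed.

(** Natural-number weights turn the uncountable infimum over the hull into countable unions, and the
    slacks [j.+1%:R^-1] give a countable intersection. *)
Lemma measurable_dist_set_le N (Xs : 'I_N -> T -> d.-tuple R) (r : R) :
  (0 < N)%N -> (forall k, random_vector (Xs k)) ->
  measurable [set w | dist_set (zero_vec R d)
    (conv_hull [set Xs k w | k in [set: 'I_N]]) <= r].
Proof.
move=> N0 mXs.
rewrite [X in measurable X](_ : _ = \bigcap_(j : nat)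
    \bigcup_(a : {ffun 'I_N -> nat})
      [set w | enorm_rv ((\row_k (a k)%:R) *m \matrix_k row_of (Xs k w))
               < (r + j.+1%:R^-1) * (\sum_k a k)%:R]); last first.
  apply/seteqP; split=> w /=.
    move=> /(dist_set_leP _ _ _ N0) h j _.
    by have /simplex_natP[a aq] := h j; exists a.
  move=> h; apply/(dist_set_leP _ _ _ N0) => j; apply/simplex_natP.
  by have [a _ aq] := h j I; exists a.
apply: bigcapT_measurable => j; apply: countable_bigcupT_measurable => [|a].
  exact: countableP.
rewrite -[X in measurable X]setTI -preimage_true.
apply: measurable_fun_ltr => //; apply: measurable_enorm_rv => i.
under eq_fun do rewrite mxE.
apply: measurable_sum => k; under eq_fun do rewrite !mxE.
by apply: measurable_funM => //; exact: measurable_coord.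
Qed.

End Measurability.

(** * Rounding to a finite grid *)

Section Quantization.
Context {R : realType} {d : nat}.

(** A cell records which coordinates pass which of finitely many thresholds spaced by [h], so it is
    a finite intersection of measurable conditions. *)
Lemma grid_cells (M h : R) : 0 < h ->
  exists (G : finType) (phi : d.-tuple R -> G),
    (forall g, measurable (phi @^-1` [set g])) /\
    (forall x y, phi x = phi y -> forall i, `|tnth x i| <= M ->
       `|tnth y i| <= M -> `|tnth x i - tnth y i| <= h).
Proof.
move=> h0; pose L := (Num.truncn (2 * M / h)).+2.
pose t (j : 'I_L) : R := - M + j%:R * h.
exists {ffun 'I_d * 'I_L -> bool}.
exists (fun x => [ffun ij => t ij.2 <= tnth x ij.1]); split=> [g|x y].
  rewrite [X in measurable X](_ : _ = \bigcap_(ij in [set: 'I_d * 'I_L])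
      [set x : d.-tuple R | (t ij.2 <= tnth x ij.1) = g ij]); last first.
    apply/seteqP; split=> x /=.
      by move=> /ffunP gE ij _; have := gE ij; rewrite ffunE.
    by move=> gE; apply/ffunP => ij; rewrite ffunE; exact: gE.
  apply: fin_bigcap_measurable => // ij _; rewrite -[X in measurable X]setTI.
  have m := @measurable_fun_ler _ (d.-tuple R) R setT (cst (t ij.2))
    (fun x => tnth x ij.1) (measurable_cst _) (measurable_tnth ij.1).
  exact: (m measurableT [set g ij]).
move=> /ffunP xy i.
wlog: x y xy / tnth y i <= tnth x i => [hw xM yM|yx xM yM].
  have [yx|/ltW yx] := leP (tnth y i) (tnth x i); first exact: hw.
  by rewrite distrC; apply: hw => // ij; rewrite xy.
rewrite ger0_norm ?subr_ge0// leNgt; apply/negP => lt.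
have /andP[yM1 yM2] : - M <= tnth y i <= M by rewrite -ler_norml.
(* The threshold of index [(Num.truncn s).+1] lies above [tnth y i] by a positive amount at most
   [h], hence below [tnth x i], so the two cells differ. The [.+2] in [L] makes room for this
   index. *)
pose s := (tnth y i + M) / h.
have s0 : 0 <= s by rewrite divr_ge0 ?(ltW h0)//; lra.
have jL : ((Num.truncn s).+1 < L)%N.
  rewrite /L !ltnS; apply: le_truncn.
  by rewrite /s ler_pM2r ?invr_gt0//; lra.
have := xy (i, Ordinal jL); rewrite !ffunE /t /=.
have sh : s * h = tnth y i + M by rewrite divfK ?gt_eqF.
have : s * h < (Num.truncn s).+1%:R * h by rewrite ltr_pM2r// truncnS_gt.
have : (Num.truncn s)%:R * h <= s * h by rewrite ler_pM2r// truncn_le.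
rewrite -natr1 mulrDl mul1r sh => a1 a2.
have -> : - M + ((Num.truncn s)%:R * h + h) <= tnth x i by lra.
by move=> /esym; apply/negP; rewrite -ltNge; lra.
Qed.

Lemma finite_quantizer (M delta : R) : 0 < delta ->
  exists (G : finType) (phi : d.-tuple R -> G) (v : G -> 'rV[R]_d),
    (forall g, measurable (phi @^-1` [set g])) /\
    (forall x, enorm x <= M -> enorm_rv (row_of x - v (phi x)) <= delta).
Proof.
(* The [d] coordinate errors add up to at most [delta]; [d.+1] also keeps the mesh positive when
   [d = 0]. *)
move=> delta0; pose h := delta / d.+1%:R.
have h0 : 0 < h by rewrite divr_gt0.
have [G [phi [mphi close]]] := grid_cells M h h0.
have coordM (x : d.-tuple R) i : enorm x <= M -> `|tnth x i| <= M.
  rewrite enormE; apply: le_trans.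
  by have := coord_le_enorm_rv (row_of x) i; rewrite mxE.
(* The representative is taken inside the ball, where cells are small; the default serves only cells
   that miss the ball. *)
pose c g := xget (zero_vec R d) [set x | phi x = g /\ enorm x <= M].
exists G, phi, (row_of \o c); split=> // x xM.
have [cx cM] : phi (c (phi x)) = phi x /\ enorm (c (phi x)) <= M.
  exact: (@xgetPex _ _ [set y | phi y = phi x /\ enorm y <= M]%classic
    (ex_intro _ x (conj erefl xM))).
apply: le_trans (enorm_rv_le_sum _) _.
apply: (@le_trans _ _ (\sum_(i < d) h)).
  apply: ler_sum => i _; rewrite !mxE; apply: close => //; exact: coordM.
rewrite sumr_const card_ord -mulr_natr /h -mulrA ger_pMr//.
by rewrite mulrC ler_pdivrMr// mul1r ler_nat.
Qed.

End Quantization.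

(** * Halfspace probability of a centered bounded vector *)

Section CenteredTail.
Context {R : realType} {dT : measure_display} {T : measurableType dT}.
Context {P : probability T R} {d : nat} {X : T -> d.-tuple R} {M : R}.
Hypothesis hX : random_vector X.
Hypothesis hM : 0 < M.
Hypothesis hcentered : forall i : 'I_d, ('E_P[fun w => tnth (X w) i] = 0%E)%E.
Hypothesis hbounded : {ae P, forall w, enorm (X w) <= M}.

(** Integrating over this event of full measure turns the almost sure bound into a pointwise one. *)
Let D := [set w | enorm (X w) <= M].

Lemma measurable_bounded_event : measurable D.
Proof.
rewrite -[D]setTI -[D]preimage_true.
by apply: measurable_fun_ler => //; exact: measurable_enorm.
Qed.
Let mD := measurable_bounded_event.

Lemma probability_unbounded_event : P (~` D) = 0%E.
Proof. by apply: measure_negligible => //; exact: measurableC. Qed.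

Lemma probability_bounded_event : P D = 1%E.
Proof.
have := probability_unbounded_event; rewrite probability_setC// => h.
have fD : P D \is a fin_num by exact: fin_num_measure.
by move: h; rewrite -(fineK fD) -EFinB => -[] /eqP; rewrite subr_eq0 => /eqP <-.
Qed.

Lemma integral_coord_bounded_event i :
  (\int[P]_(w in D) (tnth (X w) i)%:E = 0)%E.
Proof.
have mXi : measurable_fun setT (fun w => (tnth (X w) i)%:E).
  by apply/measurable_EFinP; exact: measurable_coord.
rewrite integral_mkcond -(hcentered i) unlock; apply: ae_eq_integral => //.
- by apply/(measurable_restrict _ mD measurableT); exact: measurable_funS mXi.
- by apply: filterS hbounded => w wM _; rewrite patchE mem_set.
Qed.

Lemma integrable_coord_bounded_event i :
  P.-integrable D (fun w => (tnth (X w) i)%:E).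
Proof.
apply: measurable_bounded_integrable => //.
- by apply: le_lt_trans (probability_le1 P mD) _; rewrite ltry.
- by apply: measurable_funTS; exact: measurable_coord.
- exists M; split; first exact: num_real.
  move=> x Mx w /= wM; apply: le_trans (ltW Mx); apply: le_trans wM.
  by have := coord_le_enorm_rv (row_of (X w)) i; rewrite mxE enormE.
Qed.

(* Markov's inequality for the nonnegative variable [<c, X> + |c| M]. *)
Lemma centered_tail (c : 'rV[R]_d) (eta : R) (B : set T) :
  c != 0 -> 0 <= eta -> measurable B ->
  (forall w, D w -> B w -> eta * enorm_rv c <= dot c (row_of (X w))) ->
  (P B <= (M / (M + eta))%:E)%E.
Proof.
move=> c0 eta0 mB hB; set a := enorm_rv c in hB.
have a0 : 0 < a by rewrite lt_neqAle enorm_rv_ge0 andbT eq_sym enorm_rv_eq0.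
pose f w := dot c (row_of (X w)) + a * M.
have mf : measurable_fun setT f.
  apply: measurable_funD => //; apply: measurable_sum => i.
  under eq_fun do rewrite mxE.
  by apply: measurable_funM => //; exact: measurable_coord.
have f0 w : D w -> 0 <= f w.
  move=> wM; rewrite /f -[dot _ _]opprK -dotNr addrC subr_ge0.
  apply: le_trans (cauchy_schwarz _ _) _; rewrite ler_wpM2l ?enorm_rv_ge0//.
  by rewrite -scaleN1r enorm_rvZ normrN1 mul1r -enormE.
have intf : (\int[P]_(w in D) (f w)%:E = (a * M)%:E)%E.
  have fE w : ((f w)%:E = (\sum_i (c 0 i)%:E * (tnth (X w) i)%:E)
      + (cst (a * M)%:E) w)%E.
    rewrite /f EFinD -sumEFin; congr (_ + _)%E.
    by apply: eq_bigr => i _; rewrite mxE EFinM.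
  have iX i : P.-integrable D (fun w => (c 0 i)%:E * (tnth (X w) i)%:E)%E.
    exact/integrableZl/integrable_coord_bounded_event.
  under eq_integral do rewrite fE.
  rewrite integralD//; last 2 first.
  - exact: integrable_sum.
  - by apply: finite_measure_integrable_cst.
  rewrite integral_sum// big1 ?add0e => [|i _].
    rewrite integral_cst// [X in (_ * X)%E](_ : _ = 1%E) ?mule1//.
    exact: probability_bounded_event.
  rewrite integralZl//; last exact: integrable_coord_bounded_event.
  by rewrite integral_coord_bounded_event mule0.
have : ((a * (M + eta))%:E * P B <= (a * M)%:E)%E.
  have -> : P B = P (B `&` D).
    transitivity (P (B `\` D) + P (B `&` D))%E; first exact: measureDI.
    rewrite (_ : P (B `\` D) = 0%E) ?add0e//; apply/eqP.
    rewrite eq_le measure_ge0 andbT -probability_unbounded_event.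
    by apply: le_measure; rewrite ?inE//; [exact: measurableD|exact: measurableC].
  have m1 : measurable_fun D (fun w => (\1_B w : R)%:E).
    by apply/measurable_EFinP; exact: measurable_indic.
  have aM : 0 <= a * (M + eta) by rewrite mulr_ge0 ?addr_ge0 ?(ltW a0) ?(ltW hM).
  rewrite -intf -(integral_indic P mD mB) -ge0_integralZl_EFin//.
  apply: ge0_le_integral => //.
  - by move=> w _; rewrite -EFinM lee_fin mulr_ge0.
  - exact: measurable_funeM.
  - by apply/measurable_EFinP; exact: measurable_funTS.
  move=> w Dw; rewrite -EFinM lee_fin indicE.
  have [wB|wB] := boolP (w \in B); last by rewrite mulr0 f0.
  rewrite mulr1 /f mulrDr addrC lerD2r mulrC; apply: hB => //; exact: set_mem.
have fB : P B \is a fin_num by exact: fin_num_measure.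
rewrite -(fineK fB) -EFinM !lee_fin => h.
rewrite ler_pdivlMr ?ltr_wpDr//.
by rewrite -(ler_pM2l a0) mulrCA mulrC.
Qed.

End CenteredTail.

(** * Events determined by a finite-valued map *)

Section FiniteFibers.
Context {R : realType} {dT : measure_display} {T : measurableType dT}.
Context (P : probability T R) {G : finType} (f : T -> G).
Hypothesis mf : forall g, measurable (f @^-1` [set g]).

Lemma measurable_fibers_seq (s : seq G) : measurable [set w | f w \in s].
Proof.
elim: s => [|g s ih].
  by rewrite [X in measurable X](_ : _ = set0)//; apply/seteqP; split.
rewrite [X in measurable X](_ : _ = f @^-1` [set g] `|` [set w | f w \in s]).
  exact: measurableU.
apply/seteqP; split=> w /=; rewrite inE.
  by move=> /orP[/eqP|]; [left|right].
by move=> [->|->]; rewrite ?eqxx ?orbT.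
Qed.

Lemma probability_fibers_seq (s : seq G) : uniq s ->
  P [set w | f w \in s] = (\sum_(g <- s) fine (P (f @^-1` [set g])))%:E.
Proof.
elim: s => [_|g s ih /andP[gs us]].
  rewrite big_nil [X in P X](_ : _ = set0) ?measure0//.
  by apply/seteqP; split.
rewrite big_cons EFinD -ih// fineK ?fin_num_measure//.
rewrite -measureU//; last 2 first.
- exact: measurable_fibers_seq.
- apply/seteqP; split=> w //= [fw]; rewrite fw => h.
  by rewrite h in gs.
congr (P _); apply/seteqP; split=> w /=; rewrite inE.
  by move=> /orP[/eqP|]; [left|right].
by move=> [->|->]; rewrite ?eqxx ?orbT.
Qed.

Lemma measurable_fibers (A : pred G) : measurable [set w | A (f w)].
Proof.
rewrite (_ : mkset _ = [set w | f w \in [seq g <- index_enum G | A g]]).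
  exact: measurable_fibers_seq.
by apply/funext => w /=; rewrite mem_filter mem_index_enum andbT.
Qed.

Lemma probability_fibers (A : pred G) :
  P [set w | A (f w)] = (\sum_(g | A g) fine (P (f @^-1` [set g])))%:E.
Proof.
rewrite -big_filter -probability_fibers_seq ?filter_uniq ?index_enum_uniq//.
by congr (P _); apply/funext => w /=; rewrite mem_filter mem_index_enum andbT.
Qed.

End FiniteFibers.

(** * From the rounded sample back to the i.i.d. sample *)

Section IidSample.
Context {R : realType} {d : nat}.
Context {dT : measure_display} {T : measurableType dT} {P : probability T R}.
Context {X : T -> d.-tuple R} {M : R}.
Hypothesis hX : random_vector X.
Hypothesis hM : 0 < M.
Hypothesis hcentered : forall i : 'I_d, ('E_P[fun w => tnth (X w) i] = 0%E)%E.
Hypothesis hbounded : {ae P, forall w, enorm (X w) <= M}.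
Context {N : nat} {dT' : measure_display} {T' : measurableType dT'}.
Context {P' : probability T' R} {Xs : 'I_N -> T' -> d.-tuple R}.
Hypothesis N_gt0 : (0 < N)%N.
Hypothesis hXs : forall k, random_vector (Xs k).
Hypothesis hlaw : forall k, same_law P P' X (Xs k).
Hypothesis hindep : mutually_independent P' Xs.

Let near (r : R) := [set w | dist_set (zero_vec R d)
  (conv_hull [set Xs k w | k in [set: 'I_N]]) <= r].

Let bounded := \bigcap_(k in [set: 'I_N]) (Xs k @^-1` [set x | enorm x <= M]).

Let measurable_ball : measurable [set x : d.-tuple R | enorm x <= M].
Proof.
rewrite -[X in measurable X]setTI -preimage_true.
by apply: measurable_fun_ler => //; apply: measurable_enorm; exact: measurable_id.
Qed.

Let measurable_bounded : measurable bounded.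
Proof.
apply: fin_bigcap_measurable => // k _.
by rewrite -[X in measurable X]setTI; exact: hXs.
Qed.

Lemma probability_all_bounded : P' bounded = 1%E.
Proof.
rewrite hindep; last by move=> k; exact: measurable_ball.
rewrite big1// => k _; rewrite -hlaw//.
exact: (probability_bounded_event hX hbounded).
Qed.

Lemma probability_near_bounded (r : R) :
  (forall w, bounded w -> near r w) -> P' (near r) = 1%E.
Proof.
move=> h; apply/eqP; have mnear := measurable_dist_set_le _ Xs r N_gt0 hXs.
rewrite eq_le probability_le1//=.
rewrite -probability_all_bounded; by apply: le_measure; rewrite ?inE.
Qed.

Section Discretized.
Context {G : finType} (phi : d.-tuple R -> G) (v : G -> 'rV[R]_d).
Variables delta eps : R.
Hypothesis mphi : forall g, measurable (phi @^-1` [set g]).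
Hypothesis phi_close : forall x, enorm x <= M ->
  enorm_rv (row_of x - v (phi x)) <= delta.
Hypothesis delta_eps : 0 <= delta <= eps.

Let wt g := fine (P (X @^-1` (phi @^-1` [set g]))).

Let mphiX g : measurable ((phi \o X) @^-1` [set g]).
Proof. by rewrite -[X in measurable X]setTI; exact: (hX measurableT _ (mphi g)). Qed.

Let joint w : {ffun 'I_N -> G} := [ffun k => phi (Xs k w)].

Let jointE x : joint @^-1` [set x] =
  \bigcap_(k in [set: 'I_N]) (Xs k @^-1` (phi @^-1` [set x k])).
Proof.
apply/seteqP; split=> w /=; first by move=> <- k _ /=; rewrite ffunE.
by move=> h; apply/ffunP => k; rewrite ffunE; exact: h.
Qed.

Let mjoint x : measurable (joint @^-1` [set x]).
Proof.
rewrite jointE; apply: fin_bigcap_measurable => // k _.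
by rewrite -[X in measurable X]setTI; exact: (hXs k measurableT _ (mphi (x k))).
Qed.

Lemma weight_sum : \sum_g wt g = 1.
Proof.
have := probability_fibers P (phi \o X) mphiX predT.
rewrite (_ : mkset _ = setT); last by apply/seteqP; split.
by rewrite probability_setT => -[].
Qed.

(** The fibers of [joint] are product events, so mutual independence and equality of laws yield the
    product weight of the finite counting argument. *)
Lemma joint_weight x : fine (P' (joint @^-1` [set x])) = \prod_k wt (x k).
Proof.
rewrite jointE hindep; last by move=> k; exact: mphi.
rewrite (eq_bigr (fun k => (wt (x k))%:E)) ?prodEFin// => k _.
rewrite -hlaw; last exact: mphi.
rewrite fineK// fin_num_measure//; exact: mphiX.
Qed.

(** Undoing the rounding costs at most [delta * enorm_rv c] in the inner product, so the tail bound
    applies with [eta = eps - delta]. *)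
Lemma weight_halfspace (c : 'rV[R]_d) : c != 0 ->
  \sum_(g | eps * enorm_rv c < dot c (v g)) wt g <= M / (M + (eps - delta)).
Proof.
case/andP: delta_eps => delta0 le_de c0.
rewrite -lee_fin; have := probability_fibers P (phi \o X) mphiX
  (fun g => eps * enorm_rv c < dot c (v g)).
move=> <-; apply: (centered_tail hX hM hcentered hbounded c) => //.
- by rewrite subr_ge0.
- exact: (measurable_fibers (phi \o X) mphiX (fun g => _ < dot c (v g))).
move=> w Dw /= wc.
have -> : row_of (X w) = v (phi (X w)) - (v (phi (X w)) - row_of (X w)).
  by rewrite opprB addrC subrK.
rewrite dotDr dotNr mulrBl; apply: lerB; first exact: ltW.
apply: le_trans (cauchy_schwarz _ _) _; rewrite mulrC ler_wpM2r ?enorm_rv_ge0//.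
by rewrite -opprB -scaleN1r enorm_rvZ normrN1 mul1r; exact: phi_close.
Qed.

(** The weights that are optimal for the rounded points are reused for the original ones; the convex
    combination moves by at most [delta]. *)
Lemma near_config w : bounded w ->
  enorm_rv (nearest (config v (joint w)) [set: 'I_N]%SET) <= eps ->
  near (eps + delta) w.
Proof.
move=> bw; have [[l [lS _ lz]] _] := nearestP (config v (joint w)) N_gt0.
rewrite -lz => le_eps; apply: (dist_set_le_enorm _ _ _ _ lS).
set Y := \matrix_k _.
rewrite -[Y](subrK (config v (joint w))) mulmxDr addrC.
apply: le_trans (enorm_rvD _ _) _; apply: lerD => //.
apply: le_trans (enorm_rv_mulmx _ _ _) _.
rewrite -[leRHS]mul1r -lS.2 mulr_suml; apply: ler_sum => k _.
rewrite ger0_norm ?lS.1// ler_wpM2l ?lS.1// linearB/= !rowK ffunE.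
by apply: phi_close; exact: bw.
Qed.

Lemma probability_near_ge :
  ((1 - \sum_(x : {ffun 'I_N -> G} |
      eps < enorm_rv (nearest (config v x) [set: 'I_N]%SET))
        \prod_k wt (x k))%:E <= P' (near (eps + delta)))%E.
Proof.
pose far := fun x : {ffun 'I_N -> G} =>
  eps < enorm_rv (nearest (config v x) [set: 'I_N]%SET).
under eq_bigr do rewrite -joint_weight.
rewrite EFinB -(probability_fibers P' joint mjoint far).
have mfar := measurable_fibers joint mjoint far.
have mnear := measurable_dist_set_le _ Xs (eps + delta) N_gt0 hXs.
rewrite -probability_setC//.
have -> : P' (~` [set w | far (joint w)]) =
    P' (~` [set w | far (joint w)] `&` bounded).
  transitivity (P' (~` [set w | far (joint w)] `\` bounded) +
    P' (~` [set w | far (joint w)] `&` bounded))%E.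
    by apply: measureDI => //; exact: measurableC.
  rewrite [X in (X + _)%E](_ : _ = 0%E) ?add0e//; apply/eqP.
  rewrite eq_le measure_ge0 andbT.
  have <- : P' (~` bounded) = 0%E.
    by rewrite probability_setC// probability_all_bounded subee.
  apply: le_measure; rewrite ?inE//.
    by apply: measurableD => //; exact: measurableC.
  exact: measurableC.
apply: le_measure; rewrite ?inE//.
  by apply: measurableI => //; exact: measurableC.
by move=> w [/negP]; rewrite -leNgt => wfar bw; exact: near_config.
Qed.

End Discretized.

Lemma probability_near_gt (n : nat) : (0 < d)%N -> (1 < n)%N ->
  (6 * d * n <= N)%N -> ((1 - 2%:R ^- d)%:E < P' (near (2 * M / n%:R)))%E.
Proof.
move=> d0 n1 dnN; have n0 : 0 < n%:R :> R by rewrite ltr0n; lia.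
(* With [eps = 7 * delta], the sum [eps + delta] is exactly [2 * M / n] and the tail margin
   [eps - delta] is [3 * M / (2 * n)]. *)
pose delta := M / (4 * n%:R).
have delta0 : 0 < delta by rewrite divr_gt0// mulr_gt0.
have [G [phi [v [mphi phi_close]]]] := @finite_quantizer R d M delta delta0.
pose eps := 7 * delta.
have -> : 2 * M / n%:R = eps + delta by rewrite /eps /delta; field; rewrite gt_eqF.
have de : 0 <= delta <= eps by rewrite /eps; lra.
apply: lt_le_trans (probability_near_ge phi v delta eps mphi phi_close).
rewrite lte_fin ltrD2l ltrN2.
pose wt g := fine (P (X @^-1` (phi @^-1` [set g]))).
pose b := M / (M + (eps - delta)).
have n2 : 2 <= n%:R :> R by rewrite (ler_nat R 2 n).
have b0 : 0 <= b.
  by rewrite divr_ge0 ?(ltW hM)// addr_ge0 ?(ltW hM)// subr_ge0; case/andP: de.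
apply: (@bin_expr_lt R _ b d n N) => //.
  (* Here [b = 1 / (1 + 6 * t)], and [b <= 1 - 3 * t] amounts to [0 <= t * (3 - 18 * t)], which
     holds since [1 < n] gives [t <= 1/8]. *)
  set t := (4 * n%:R)^-1; have t0 : 0 < t by rewrite invr_gt0 mulr_gt0.
  have t8 : t <= 8^-1 by rewrite lef_pV2 ?posrE; lra.
  rewrite /b /eps /delta -/t.
  have M0 : 0 < M := hM.
  have Mt : 0 < M * t by rewrite mulr_gt0.
  rewrite ler_pdivrMr; last by lra.
  have : 0 <= M * t * (3 - 18 * t) by rewrite !mulr_ge0 ?(ltW hM) ?(ltW t0)//; lra.
  lra.
apply: (sum_far_le wt b) => //.
- by move=> g; exact: fine_ge0.
- exact: weight_sum.
- by case/andP: de => /le_trans; apply.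
- by move=> c c0; exact: weight_halfspace.
Qed.

End IidSample.

(** * Degenerate parameters and the general case *)

Theorem theorem4 (R : realType) (d : nat)
  (dT : measure_display) (T : measurableType dT) (P : probability T R)
  (X : T -> d.-tuple R) (M : R)
  (hX : random_vector X)
  (hM : 0 < M)
  (hcentered : forall i : 'I_d, ('E_P[fun w => tnth (X w) i] = 0%E)%E)
  (hbounded : {ae P, forall w, enorm (X w) <= M})
  (n N : nat) (hn : (0 < n)%N) (hN : (0 < N)%N) (hNn : (6 * d * n <= N)%N)
  (dT' : measure_display) (T' : measurableType dT') (P' : probability T' R)
  (Xs : 'I_N -> T' -> d.-tuple R)
  (hXs : forall k, random_vector (Xs k))
  (hlaw : forall k, same_law P P' X (Xs k))
  (hindep : mutually_independent P' Xs) :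
  (P' [set w | (dist_set (zero_vec R d) (conv_hull [set Xs k w | k in [set: 'I_N]])
                 <= 2 * M / n%:R)%R]
   > (1 - 2%:R ^- d)%:E)%E.
Proof.
(* For [d = 0] or [n = 1] a single sample point is close enough: its norm is 0, respectively at most
   [M <= 2 * M]. The probability is then 1, which exceeds the bound. *)
have near1 : (forall w,
    (\bigcap_(k in [set: 'I_N]) (Xs k @^-1` [set x | enorm x <= M])) w ->
    enorm (Xs (Ordinal hN) w) <= 2 * M / n%:R) ->
  P' [set w | dist_set (zero_vec R d)
    (conv_hull [set Xs k w | k in [set: 'I_N]]) <= 2 * M / n%:R] = 1%E.
  move=> h; apply: (probability_near_bounded hX hbounded hN hXs hlaw hindep).
  move=> w /h; rewrite enormE => le_r.
  apply: (dist_set_le_enorm _ _ _ _ (simplex_delta _ (Ordinal hN))).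
  by rewrite -rowE rowK.
have lt1 : ((1 - 2%:R ^- d)%:E < 1 :> \bar R)%E.
  by rewrite lte_fin gtrBl invr_gt0 exprn_gt0.
have [d0|d0] := posnP d.
  rewrite near1// => w _; apply: (@le_trans _ _ 0); last first.
    by rewrite divr_ge0// mulr_ge0// ltW.
  by rewrite enormE /enorm_rv /dot; subst d; rewrite big_ord0 sqrtr0.
have [n1|n1] := leqP n 1.
  rewrite near1// => w /(_ (Ordinal hN) I) /= le_M.
  have -> : n = 1%N by lia.
  by apply: le_trans le_M _; rewrite divr1; lra.
exact: (probability_near_gt hX hM hcentered hbounded hN hXs hlaw hindep).
Qed.
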